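(* Every subcubic graph $G$ with $\mathrm{mad}(G) < \frac{20}{9}$ has a $(1^2,2^2)$-packing edge-coloring.
   Context: Graphs are simple. A graph is subcubic if its maximum degree is at most $3$. The maximum average degree is $\mathrm{mad}(G)=\max\{2|E(H)|/|V(H)| : H\subseteq G\}$. The distance between two edges is the distance between the corresponding vertices in the line graph. A $(1^2,2^2)$-packing edge-coloring of $G$ is a partition of $E(G)$ into two matchings and two induced matchings, i.e. sets $E_1,E_2,E_3,E_4$ such that distinct edges in the same $E_i$ are at distance at least $2$ for $i\in\{1,2\}$ and at distance at least $3$ for $i\in\{3,4\}$. *)

(* Defs.v *)
(* A simple graph is a symmetric irreflexive relation e on a finType T. *)
From mathcomp Require Import all_boot all_order all_algebra.
Set Implicit Arguments. Unset Strict Implicit. Unset Printing Implicit Defensive.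
Import Order.TTheory GRing.Theory Num.Theory.

Section Graph.
Variables (T : finType) (e : rel T).

Definition edges : {set {set T}} :=
  [set f : {set T} | [exists x, exists y, e x y && (f == [set x; y])]].

Definition degree (x : T) : nat := #|[set y | e x y]|.

Definition subcubic : Prop := forall x : T, degree x <= 3.

Definition is_subgraph (S : {set T}) (F : {set {set T}}) : Prop :=
  F \subset edges /\ (forall f, f \in F -> f \subset S).

Definition mad_lt (r : rat) : Prop :=
  forall (S : {set T}) (F : {set {set T}}), is_subgraph S F -> S != set0 ->
    ((2 * #|F|)%:R / #|S|%:R < r)%R.

Definition edge_adj (f g : {set T}) : bool :=
  [&& f \in edges, g \in edges, f != g & f :&: g != set0].

(* distance >= 2 in the line graph, for distinct edges *)
Definition dist_ge2 (f g : {set T}) : bool := ~~ edge_adj f g.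

(* distance >= 3 in the line graph, for distinct edges *)
Definition dist_ge3 (f g : {set T}) : bool :=
  ~~ edge_adj f g && ~~ [exists h, edge_adj f h && edge_adj h g].

(* (1^2,2^2)-packing edge-coloring: colours 0,1 are matchings,
   colours 2,3 are induced matchings. *)
Definition packing_1122 : Prop :=
  exists c : {set T} -> 'I_4,
    forall f g, f \in edges -> g \in edges -> f != g -> c f = c g ->
      (((c f : nat) < 2) -> dist_ge2 f g) /\ ((2 <= (c f : nat)) -> dist_ge3 f g).

End Graph.

(* Main.v *)
(** Colour the vertices with two colours so that every vertex has at most one
neighbour of its own colour and at most two of the other colour.  Monochromatic
edges then form a matching, each of whose two colour classes is induced, since
an edge joining two edges of one class would itself be monochromatic.
Bichromatic edges form a bipartite graph of maximum degree 2, which is a union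
of two matchings.

In a vertex-minimal graph without such a vertex colouring all degrees are 2 or
3, there is no path of four vertices of degree 2, and no vertex of degree 3 is
the origin of three threads (paths of vertices of degree 2) of lengths at least
3, 3 and 2.  So the threads at a vertex of degree 3 have total length at most 7,
while every vertex of degree 2 is counted twice: 2 n_2 <= 7 n_3, that is,
average degree at least 20/9. *)

Require Import Defs.
From mathcomp Require Import all_boot all_order all_algebra.
From mathcomp Require Import zify.

Set Implicit Arguments. Unset Strict Implicit. Unset Printing Implicit Defensive.

Import Order.TTheory GRing.Theory Num.Theory.

(** * Two-colourings flipped by two involutions, and edge colouring at maximum degree 2 *)

Section TwoInvolutions.
Variable X : finType.
Implicit Types alpha beta : X -> X.

(* A point and its image under alpha lie in different orbits of alpha \o beta,
   whereas beta x and alpha x lie in the same one, so a colouring that separates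
   the orbits of x and alpha x flips under both involutions. *)
Lemma fixfree_involutions_2col (Y : finType) (alpha beta : Y -> Y) :
    involutive alpha -> involutive beta ->
    (forall x, alpha x != x) -> (forall x, beta x != x) ->
  exists c : Y -> bool, forall x, c (alpha x) = ~~ c x /\ c (beta x) = ~~ c x.
Proof.
move=> aK bK aF bF; pose p x := alpha (beta x).
have pI : injective p by move=> x y /(inv_inj aK)/(inv_inj bK).
(* The induction goes down by two: [alpha (p x)] is [beta x], so an equality of [alpha x] with the
   iterate [k.+2] of [p] at [x] would give one of [alpha (p x)] with the iterate [k] at [p x]. *)
have aNiter k : forall x, alpha x != iter k p x.
  elim/ltn_ind: k => -[|[|k]] IH x /=; first exact: aF.
    by rewrite (inj_eq (inv_inj aK)) eq_sym bF.
  rewrite -[p (iter k p x)]/(iter k.+1 p x) iterSr (inj_eq (inv_inj aK)).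
  apply/eqP => Ex; have /negP[] := IH k (leqnSn _) (p x).
  by apply/eqP; rewrite {1}/p aK {1}Ex bK.
pose r := froot p.
have rE x y : fconnect p x y -> r x = r y.
  by move=> xy; apply/eqP; rewrite root_connect //; apply: fconnect_sym.
have rp x : r (p x) = r x by apply/esym/rE/fconnect1.
have ra x : r (alpha x) != r x.
  rewrite root_connect; last exact: fconnect_sym.
  rewrite fconnect_sym //; apply/negP => /iter_findex E.
  by have /negP[] := aNiter (findex p x (alpha x)) x; rewrite E.
have rab x : r (alpha (p x)) = r (alpha x).
  by rewrite {1}/p aK -(rp (beta x)) /p bK.
exists (fun x => enum_rank (r x) < enum_rank (r (alpha x))) => x.
have Hne y : (enum_rank (r (alpha y)) == enum_rank (r y) :> nat) = false.
  by apply/negbTE; apply: contra (ra y) => /eqP/ord_inj/enum_rank_inj->.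
split; first by rewrite aK ltn_neqAle Hne /= leqNgt.
have -> : r (beta x) = r (alpha x) by rewrite -rab /p aK.
by rewrite -/(p x) rp ltn_neqAle Hne /= leqNgt.
Qed.

(* Two copies of X glued along the fixed points of each involution. *)
Lemma involutions_2col alpha beta :
    involutive alpha -> involutive beta ->
  exists c : X -> bool, forall x,
    (alpha x != x -> c (alpha x) = ~~ c x) /\
    (beta x != x -> c (beta x) = ~~ c x).
Proof.
move=> aK bK.
pose dbl (f : X -> X) (u : X * bool) :=
  if f u.1 == u.1 then (u.1, ~~ u.2) else (f u.1, u.2).
have dblK f : involutive f -> involutive (dbl f).
  move=> fK [x b]; rewrite /dbl /=; have [Ex|Ex] := eqVneq (f x) x; rewrite /=.
    by rewrite Ex eqxx negbK.
  by rewrite fK eq_sym (negbTE Ex).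
have dblF f : forall u, dbl f u != u.
  move=> [x b]; rewrite /dbl /=; case: ifP => Ex; rewrite xpair_eqE ?Ex //.
  by rewrite eqxx; case: b.
have [c cP] := fixfree_involutions_2col (dblK _ aK) (dblK _ bK) (dblF _) (dblF _).
exists (fun x => c (x, false)) => x; have := cP (x, false).
by rewrite /dbl /=; do 2!case: ifP => //; move=> _ _ [].
Qed.

End TwoInvolutions.

(** The pairs [(a, b)] with [o a b] are the edges of the bipartite double cover of [o]. Passing to
    the other edge at the first end, or at the second end, is an involution that fixes an edge
    without such a partner; a colouring that flips under both is a proper edge colouring of the
    cover. *)
Lemma degree2_2edgecol (T : finType) (o : rel T) :
    symmetric o -> (forall v, #|[set u | o v u]| <= 2) ->
  exists col : T * T -> bool,
    (forall a b b', o a b -> o a b' -> b != b' -> col (a, b) != col (a, b')) /\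
    (forall a a' b, o a b -> o a' b -> a != a' -> col (a, b) != col (a', b)).
Proof.
move=> oS o2.
(* The default [b] makes [other a] a total map that fixes every point without a partner, hence an
   involution. *)
pose other a b := odflt b [pick b' | [&& o a b, o a b' & b' != b]].
have otherE a b b' : o a b -> o a b' -> b' != b -> other a b = b'.
  move=> ab ab' nb; rewrite /other; case: pickP => [c /and3P[_ ac nc]|/(_ b')] /=.
    apply/eqP; apply/negPn/negP => ncb'; have := o2 a; rewrite leqNgt => /negP[].
    have : [set b; b'; c] \subset [set u | o a u].
      by apply/subsetP => u; rewrite !inE => /orP[/orP[]|] /eqP->.
    move/subset_leq_card; apply: leq_trans.
    by rewrite setUC cardsU1 !inE negb_or nc ncb' cards2 eq_sym nb.
  by rewrite ab ab' nb.
have otherK a : involutive (other a).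
  move=> b; rewrite {2}/other; case: pickP => [b' /and3P[ab ab' nb] /=|/= nob].
    by apply: otherE; rewrite // eq_sym.
  by rewrite /other; case: pickP => // c; rewrite nob.
have [|| c cP] := @involutions_2col _ (fun u => (u.1, other u.1 u.2))
  (fun u => (other u.2 u.1, u.2)); try by move=> [a b] /=; rewrite otherK.
exists c; split=> [a b b' ab ab' nb | a a' b ab ab' nb].
  rewrite eq_sym in nb; have [+ _] := cP (a, b); rewrite /= (otherE a b b') //.
  by rewrite xpair_eqE eqxx nb => -> //; case: (c _).
rewrite eq_sym in nb; have [_ +] := cP (a, b); rewrite /= (otherE b a a') 1?oS //.
by rewrite xpair_eqE eqxx andbT nb => -> //; case: (c _).
Qed.

(** * From balanced vertex colourings to packing edge-colourings *)

Section Packing.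
Variables (T : finType) (e : rel T).
Hypotheses (Hsym : symmetric e) (Hirr : irreflexive e).

Lemma edgesP f : reflect (exists x y, e x y /\ f = [set x; y]) (f \in edges e).
Proof.
rewrite inE; apply: (iffP existsP) => [[x /existsP[y /andP[xy /eqP->]]]|].
  by exists x, y.
by move=> [x [y [xy ->]]]; exists x; apply/existsP; exists y; rewrite xy eqxx.
Qed.

Lemma edge_mem f x y : f \in edges e -> x \in f -> y \in f -> x != y ->
  e x y /\ f = [set x; y].
Proof.
case/edgesP=> p [q [pq ->]]; rewrite !inE.
move=> /orP[]/eqP-> /orP[]/eqP-> ne; rewrite ?eqxx // in ne *.
by rewrite Hsym setUC.
Qed.

Lemma edge_ends f x : f \in edges e -> x \in f -> exists y, e x y /\ f = [set x; y].
Proof.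
case/edgesP=> p [q [pq ->]]; rewrite !inE => /orP[]/eqP->; first by exists q.
by exists p; rewrite Hsym setUC.
Qed.

Definition balanced (phi : T -> bool) :=
  forall v, #|[set u | e v u & phi u == phi v]| <= 1 /\
            #|[set u | e v u & phi u != phi v]| <= 2.

Lemma balanced_packing phi : balanced phi -> packing_1122 e.
Proof.
move=> bal; pose o := [rel x y | e x y && (phi y != phi x)].
have oS : symmetric o by move=> x y; rewrite /= Hsym eq_sym.
have [|col [colr coll]] := degree2_2edgecol oS; first by move=> v; case: (bal v).
have same1 v u u' : e v u -> e v u' -> phi u = phi v -> phi u' = phi v -> u = u'.
  move=> vu vu' pu pu'; have /card_le1_eqP := (bal v).1.
  by apply; rewrite inE ?vu ?vu' ?pu ?pu' eqxx.
pose mono (b : bool) (f : {set T}) := [forall x in f, phi x == b].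
have monoP b f x : mono b f -> x \in f -> phi x = b.
  by move=> /forall_inP h /h /eqP.
(* A bichromatic edge is read as the pair of its [true] end and its [false] end, in this order,
   because [col] may differ on [(a, b)] and [(b, a)]. Two such edges that meet then share a first or
   a second component. *)
pose colf (f : {set T}) :=
  [exists a, exists b, [&& f == [set a; b], phi a, ~~ phi b & col (a, b)]].
have colfE a b : phi a -> ~~ phi b -> colf [set a; b] = col (a, b).
  move=> pa pb; apply/idP/idP => [|cab].
    case/existsP=> a' /existsP[b' /and4P[/eqP E pa' pb']].
    have: b' \in [set a; b] by rewrite E !inE eqxx orbT.
    have: a' \in [set a; b] by rewrite E !inE eqxx.
    rewrite !inE => /orP[]/eqP Ea; last by rewrite Ea (negbTE pb) in pa'.
    case/orP=> /eqP Eb; first by rewrite Eb pa in pb'.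
    by rewrite Ea Eb.
  by apply/existsP; exists a; apply/existsP; exists b; rewrite eqxx pa pb.
pose c f : 'I_4 := inord (if mono true f then 2 else if mono false f then 3
                          else if colf f then 1 else 0).
have cE f : c f = (if mono true f then 2 else if mono false f then 3
                   else if colf f then 1 else 0) :> nat.
  by rewrite inordK //; do !case: ifP.
have bichrom f : f \in edges e -> ~~ mono true f -> ~~ mono false f ->
    exists a b, [/\ e a b, f = [set a; b], phi a & ~~ phi b].
  case/edgesP=> x [y [xy ->]].
  have mE b : phi x = b -> phi y = b -> mono b [set x; y].
    by move=> px py; apply/forall_inP => z; rewrite !inE => /orP[]/eqP->; apply/eqP.
  case Ex: (phi x); case Ey: (phi y) => mt mf.
  - by rewrite mE in mt.
  - by exists x, y; rewrite Ex Ey.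
  - by exists y, x; rewrite Ex Ey Hsym setUC.
  - by rewrite mE in mf.
have monomeet b f g x : f \in edges e -> g \in edges e -> mono b f -> mono b g ->
    x \in f -> x \in g -> f = g.
  move=> fE gE mf mg xf xg.
  have [y [xy Ef]] := edge_ends fE xf; have [z [xz Eg]] := edge_ends gE xg.
  have yf : y \in f by rewrite Ef !inE eqxx orbT.
  have zg : z \in g by rewrite Eg !inE eqxx orbT.
  rewrite Ef Eg; congr [set _; _]; apply: (same1 x) => //.
    by rewrite (monoP b f x) // (monoP b f y).
  by rewrite (monoP b f x) // (monoP b g z).

exists c => f g fE gE nfg /(congr1 val) /=; rewrite !cE => Efg; split.
  case: (boolP (mono true f)) Efg => // mtf; case: (boolP (mono false f)) => // mff.
  case: (boolP (mono true g)) => [_|mtg]; first by case: ifP.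
  case: (boolP (mono false g)) => [_|mfg]; first by case: ifP.
  move=> Ec _; apply/negP => /and4P[_ _ _ /set0Pn[v]].
  have [a [b [ab Ef pa pb]]] := bichrom f fE mtf mff.
  have [a' [b' [ab' Eg pa' pb']]] := bichrom g gE mtg mfg.
  have {}Ec : col (a, b) = col (a', b').
    by rewrite -!colfE // -Ef -Eg; move: Ec; do 2!case: (colf _).
  have oab : o a b by rewrite /= ab pa (negbTE pb).
  have oab' : o a' b' by rewrite /= ab' pa' (negbTE pb').
  rewrite Ef Eg !inE => /andP[/orP[]/eqP-> /orP[]/eqP E].
  - have : col (a, b) != col (a, b').
      apply: colr; rewrite // ?E //.
      by apply: contra nfg => /eqP Eb; rewrite Ef Eg E Eb.
    by rewrite Ec E eqxx.
  - by rewrite -E pa in pb'.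
  - by rewrite E pa' in pb.
  have : col (a, b) != col (a', b).
    apply: coll; rewrite // ?E //.
    by apply: contra nfg => /eqP Ea; rewrite Ef Eg E Ea.
  by rewrite Ec E eqxx.
have {}Efg : 2 <= c f -> exists b, mono b f /\ mono b g.
  rewrite cE; move: Efg.
  case: (boolP (mono true f)) => mtf.
    case: (boolP (mono true g)) => mtg; first by exists true.
    by do !case: ifP.
  case: (boolP (mono false f)) => mff; last by case: ifP.
  case: (boolP (mono true g)) => // mtg.
  case: (boolP (mono false g)) => mfg; first by exists false.
  by case: ifP.
rewrite -cE => /Efg[b [mf mg]].
have disj v : v \in f -> v \in g -> False.
  by move=> vf vg; case/eqP: nfg; apply: (monomeet b f g v).
apply/andP; split.
  by apply/negP => /and4P[_ _ _ /set0Pn[v /setIP[vf vg]]]; apply: (disj v).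
apply/negP => /existsP[h /andP[/and4P[_ hE /eqP nfh /set0Pn[u /setIP[uf uh]]]]].
move=> /and4P[_ _ _ /set0Pn[w /setIP[wh wg]]].
(* The linking edge [h] has its ends in [f] and [g], both of colour [b]. At [u], both [f] and [h]
   lead to a neighbour of its own colour, so they coincide. *)
have uw : u != w by apply/eqP => E; apply: (disj u); rewrite // E.
have [euw Eh] := edge_mem hE uh wh uw.
have [y [uy Ef]] := edge_ends fE uf.
have yf : y \in f by rewrite Ef !inE eqxx orbT.
case: nfh; rewrite Ef Eh; congr [set _; _]; apply: (same1 u) => //.
  by rewrite (monoP b f u) // (monoP b f y).
by rewrite (monoP b f u) // (monoP b g w).
Qed.

End Packing.

(** * Auxiliary facts on sums and cardinalities *)

Section Sums.
Variable T : finType.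

Lemma sum_uniq (f : T -> nat) : (forall u v, 0 < f u -> 0 < f v -> u = v) ->
  \sum_u f u = 0 \/ exists u, 0 < f u /\ \sum_u f u = f u.
Proof.
move=> f1; have [u fu|f0] := pickP (fun u => 0 < f u); last first.
  by left; apply: big1 => u _; apply/eqP; rewrite -leqn0 leqNgt f0.
right; exists u; split=> //; rewrite (bigD1 u) //= big1 ?addn0 // => v nv.
by apply/eqP; rewrite -leqn0 leqNgt; apply: contra nv => fv; rewrite (f1 v u).
Qed.

(** This and the next lemma re-index a sum over walks by the last vertex instead of the first. *)
Lemma sum_rev3 (f : T -> T -> T -> nat) :
  \sum_x \sum_a \sum_b f x a b = \sum_b \sum_a \sum_x f x a b.
Proof.
rewrite exchange_big [RHS]exchange_big; apply: eq_bigr => a _.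
by rewrite exchange_big.
Qed.

Lemma sum_rev4 (f : T -> T -> T -> T -> nat) :
  \sum_x \sum_a \sum_b \sum_c f x a b c = \sum_c \sum_b \sum_a \sum_x f x a b c.
Proof.
under eq_bigr => x _ do rewrite sum_rev3.
rewrite exchange_big; apply: eq_bigr => c _.
by rewrite exchange_big; apply: eq_bigr => b _; rewrite exchange_big.
Qed.

Lemma cards3E (A : {set T}) : #|A| = 3 ->
  exists a b c, [/\ A = [set a; b; c], a != b, a != c & b != c].
Proof.
move=> A3; have /card_gt2P[a [b [c [[aA bA cA] [ab bc ca]]]]] : 2 < #|A| by rewrite A3.
rewrite eq_sym in ca; exists a, b, c; split=> //; apply/esym/eqP.
rewrite eqEcard A3 setUC cardsU1 cards2 !inE ab ![c == _]eq_sym negb_or ca bc /=.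
by rewrite andbT; apply/subsetP => u; rewrite !inE => /or3P[]/eqP->.
Qed.

End Sums.

(** * Balanced colourings of induced subgraphs *)

Section Critical.
Variables (T : finType) (e : rel T).
Hypotheses (Hsym : symmetric e) (Hirr : irreflexive e).
Implicit Types (S D : {set T}) (phi : T -> bool).

(** Induced subgraphs are given by vertex sets of the fixed type [T], and colourings stay defined on
    all of [T], so deleting vertices changes no type. *)
Definition nb S v := [set u in S | e v u].

Definition good S phi v :=
  (#|[set u in nb S v | phi u == phi v]| <= 1) &&
  (#|[set u in nb S v | phi u != phi v]| <= 2).

Definition balanceable S := exists phi, forall v, v \in S -> good S phi v.

Lemma nb_split S phi v :
  #|nb S v| = #|[set u in nb S v | phi u == phi v]| +
              #|[set u in nb S v | phi u != phi v]|.
Proof.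
rewrite -(cardsID [set u | phi u == phi v] (nb S v)).
by congr (_ + _); apply: eq_card => u; rewrite !inE // andbC.
Qed.

(** Degree at most 2 bounds the other colour, and one neighbour of the other colour leaves at most
    one of the own colour. *)
Lemma good_deg2 S phi v u :
  #|nb S v| <= 2 -> u \in nb S v -> phi u != phi v -> good S phi v.
Proof.
move=> d uv ne; rewrite /good.
have := nb_split S phi v.
have : 0 < #|[set u in nb S v | phi u != phi v]|.
  by apply/card_gt0P; exists u; rewrite inE uv.
lia.
Qed.

Lemma good_deg3 S phi v a1 a2 a3 :
    #|nb S v| <= 3 -> a1 \in nb S v -> a2 \in nb S v -> a3 \in nb S v ->
    a1 != a2 -> phi a1 != phi v -> phi a2 != phi v -> phi a3 = phi v ->
  good S phi v.
Proof.
move=> d v1 v2 v3 ne p1 p2 p3; rewrite /good.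
have := nb_split S phi v.
have : 0 < #|[set u in nb S v | phi u == phi v]|.
  by apply/card_gt0P; exists a3; rewrite inE v3 p3 /=.
have : 1 < #|[set u in nb S v | phi u != phi v]|.
  by apply/card_gt1P; exists a1, a2; rewrite !inE in v1 v2 *; rewrite ?v1 ?v2.
lia.
Qed.

Lemma good_off S D phi psi v :
    v \in S :\: D -> (forall u, u \notin D -> psi u = phi u) ->
    [disjoint nb S v & D] -> good (S :\: D) phi v -> good S psi v.
Proof.
rewrite inE => /andP[vD vS] agree /pred0P dis; rewrite /good.
have nbE u : (u \in nb S v) = (u \in nb (S :\: D) v).
  have := dis u; rewrite !inE /=; case: (u \in D) => /=; rewrite ?andbF //.
  by rewrite andbT => ->.
have pE u : u \in nb (S :\: D) v -> psi u = phi u.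
  by rewrite !inE => /andP[/andP[uD _] _]; apply: agree.
rewrite (agree v vD); congr (_ && _); congr (_ <= _); apply: eq_card => u;
  rewrite inE [RHS]inE nbE; by case: (boolP (u \in nb _ v)) => // /pE ->.
Qed.

Lemma nb_sym S u v : u \in S -> v \in S -> (u \in nb S v) = (v \in nb S u).
Proof. by move=> uS vS; rewrite !inE uS vS Hsym. Qed.

Lemma nb_meet S D v : v \in S -> D \subset S -> ~~ [disjoint nb S v & D] ->
  exists2 u, u \in D & v \in nb S u.
Proof.
move=> vS DS /pred0Pn[u /= /andP[uv uD]]; exists u => //.
by rewrite nb_sym // (subsetP DS).
Qed.

(** * Reducible configurations in a minimal set without balanced colouring *)

Variable S : {set T}.
Hypothesis deg3 : forall v, v \in S -> #|nb S v| <= 3.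
Hypothesis S_min : forall S', S' \proper S -> balanceable S'.
Hypothesis S_crit : ~ balanceable S.

Definition deg2 v := (v \in S) && (#|nb S v| == 2).

Lemma nb2 v p q : deg2 v -> p \in nb S v -> q \in nb S v -> p != q ->
  nb S v = [set p; q].
Proof.
move=> /andP[_ /eqP d] pv qv ne; apply/esym/eqP; rewrite eqEcard d cards2 ne.
by rewrite andbT; apply/subsetP => u /set2P[]->.
Qed.

(** Common frame of the reductions: minimality colours [S :\: D], [psi_of] extends that colouring to
    [D], and only [D] and its neighbours remain to be checked, since nothing changes around the
    other vertices. *)
Lemma recolor D (psi_of : (T -> bool) -> T -> bool) :
    D \subset S -> D != set0 ->
    (forall phi u, u \notin D -> psi_of phi u = phi u) ->
    (forall phi v, (forall w, w \in S :\: D -> good (S :\: D) phi w) ->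
       v \in S -> v \in D \/ ~~ [disjoint nb S v & D] ->
       good S (psi_of phi) v) ->
  False.
Proof.
move=> DS /set0Pn[x xD] agree ext.
have [|phi phiP] := S_min (S' := S :\: D).
  rewrite properEneq subsetDl andbT; apply/eqP => /setP/(_ x).
  by rewrite inE xD (subsetP DS).
apply: S_crit; exists (psi_of phi) => v vS.
have [vD|vD] := boolP (v \in D); first by apply: ext => //; left.
have [dis|ndis] := boolP [disjoint nb S v & D]; last by apply: ext => //; right.
have vSD : v \in S :\: D by rewrite inE vD.
by apply: (good_off vSD (agree phi)) => //; apply: phiP.
Qed.

(** A vertex [v] with at most one neighbour can be deleted and coloured last, so that its neighbour
    ends up with exactly one neighbour of its own colour, and hence at most two of the other. *)
Lemma crit_deg v : v \in S -> 2 <= #|nb S v|.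
Proof.
move=> vS; rewrite ltnNge; apply/negP => d1.
have vv : v \notin nb S v by rewrite inE Hirr andbF.
(* The quantifier over [w] picks the only neighbour of [v]. Its colour is copied, or flipped if it
   already has a neighbour of its own colour; an isolated [v] gets [false]. *)
pose psi (phi : T -> bool) u :=
  if u == v then
    [exists w in nb S v, phi w (+) [exists z in nb (S :\ v) w, phi z == phi w]]
  else phi u.
have psiE phi u : u != v -> psi phi u = phi u by rewrite /psi => /negbTE->.
apply: (@recolor [set v] psi); rewrite ?sub1set //.
- by apply/set0Pn; exists v; rewrite inE.
- by move=> phi u; rewrite inE; apply: psiE.
move=> phi u phiP uS; rewrite inE => -[/eqP-> | ].
  by rewrite /good; have := nb_split S (psi phi) v; lia.
rewrite disjoint_sym disjoints1 negbK nb_sym // => uv.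
have nuv : u != v by apply: contraNneq vv => E; rewrite -{1}E.
have onlyu w : w \in nb S v -> w = u.
  by move=> wv; apply: (card_le1_eqP d1).
pose s := [exists z in nb (S :\ v) u, phi z == phi u].
have psiv : psi phi v = phi u (+) s.
  rewrite /psi eqxx; apply/existsP/idP => [[w /andP[/onlyu-> //]]|h].
  by exists u; rewrite uv.
have /andP[same1 _] : good (S :\ v) phi u by apply: phiP; rewrite !inE nuv.
suff same : #|[set z in nb S u | psi phi z == psi phi u]| = 1.
  by rewrite /good same /=; have := nb_split S (psi phi) u; have := deg3 uS; lia.
rewrite (psiE phi u nuv); case: (boolP s) => hs.
  have := hs => /existsP[z0 z0P].
  apply/eqP; rewrite eqn_leq; apply/andP; split.
    apply: leq_trans same1; apply: subset_leq_card; apply/subsetP => z.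
    rewrite inE => /andP[zu]; have [->|nz] := eqVneq z v.
      by rewrite psiv hs; case: (phi u).
    by rewrite psiE // !inE nz => ->; move: zu; rewrite inE => ->.
  apply/card_gt0P; exists z0; move: z0P; rewrite !inE.
  by case/andP=> /andP[/andP[nz ->] ->]; rewrite psiE.
rewrite -(cards1 v); apply: eq_card => z; rewrite !inE.
have [->|nz] := eqVneq z v.
  by rewrite psiv (negbTE hs) addbF eqxx vS; move: uv; rewrite inE uS Hsym => /= ->.
rewrite psiE //; apply: contraNF hs => /andP[/andP[zS uz] pz].
by apply/existsP; exists z; rewrite !inE nz zS uz.
Qed.

(** The inner vertices [b] and [c] are deleted and coloured opposite to [a] and [d] respectively.
    Each of the four then has a neighbour of the other colour, which suffices at degree 2. The
    triangle [a = d] is covered. *)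
Lemma crit_path a b c d :
    deg2 a -> deg2 b -> deg2 c -> deg2 d -> e a b -> e b c -> e c d ->
    a != c -> b != d -> False.
Proof.
move=> da db dc dd ab bc cd nac nbd.
have [[aS /eqP d2a] [bS /eqP d2b]] := (andP da, andP db).
have [[cS /eqP d2c] [dS /eqP d2d]] := (andP dc, andP dd).
have nbb : nb S b = [set a; c] by apply: nb2; rewrite // inE ?aS ?cS // Hsym.
have nbc : nb S c = [set b; d] by apply: nb2; rewrite // inE ?bS ?dS // Hsym.
have e_ne x y : e x y -> x != y by apply: contraTneq => ->; rewrite Hirr.
have [[nab ncd] nbc'] := (e_ne _ _ ab, e_ne _ _ cd, e_ne _ _ bc).
pose psi (phi : T -> bool) v :=
  if v == b then ~~ phi a else if v == c then ~~ phi d else phi v.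
have DS : [set b; c] \subset S by apply/subsetP => v /set2P[]->.
apply: (@recolor [set b; c] psi) => //.
- by apply/set0Pn; exists b; rewrite !inE eqxx.
- by move=> phi v; rewrite /psi !inE negb_or => /andP[/negbTE-> /negbTE->].
move=> phi v _ vS vD.
have psia : psi phi b != psi phi a.
  by rewrite /psi eqxx (negbTE nab) (negbTE nac); case: (phi a).
have psid : psi phi c != psi phi d.
  rewrite /psi eqxx [c == b]eq_sym (negbTE nbc') [d == b]eq_sym (negbTE nbd).
  by rewrite [d == c]eq_sym (negbTE ncd); case: (phi d).
suff : v \in [:: a; b; c; d].
  rewrite !inE => /or4P[]/eqP->.
  - by apply: (@good_deg2 _ _ _ b); rewrite ?d2a // inE bS.
  - by apply: (@good_deg2 _ _ _ a); rewrite ?d2b 1?eq_sym // inE aS Hsym.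
  - by apply: (@good_deg2 _ _ _ d); rewrite ?d2c 1?eq_sym // inE dS.
  - by apply: (@good_deg2 _ _ _ c); rewrite ?d2d // inE cS Hsym.
case: vD => [/set2P[]->|]; rewrite ?inE ?eqxx ?orbT //.
by case/(nb_meet vS DS) => u /set2P[]->; rewrite ?nbb ?nbc => /set2P[]->;
  rewrite eqxx ?orbT.
Qed.

(** After deletion of [x], the [ai], [b1] and [b2], the vertices [x] and [a3] get the colour
    opposite to [b3], while [a1] and [a2] get that of [b3]; then [b1] and [b2] are coloured opposite
    to [c1] and [c2]. So [x] has one neighbour of its own colour and two of the other, and the
    degree-2 vertices concerned each have a neighbour of the other colour. Most of the proof shows
    that coincidences between the threads do no harm. *)
Lemma crit_332 x a1 b1 c1 a2 b2 c2 a3 b3 :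
    x \in S -> nb S x = [set a1; a2; a3] -> #|nb S x| = 3 ->
    [/\ deg2 a1, deg2 b1 & deg2 c1] -> [/\ deg2 a2, deg2 b2 & deg2 c2] ->
    deg2 a3 -> deg2 b3 ->
    e a1 b1 -> e b1 c1 -> a1 != c1 ->
    e a2 b2 -> e b2 c2 -> a2 != c2 -> e a3 b3 -> False.
Proof.
move=> xS nbx d3x [da1 db1 dc1] [da2 db2 dc2] da3 db3 ab1 bc1 ac1 ab2 bc2 ac2 ab3.
have [n12 n13 n23] : [/\ a1 != a2, a1 != a3 & a2 != a3].
  move: d3x; rewrite nbx setUC cardsU1 cards2 !inE ![a3 == _]eq_sym.
  by do 3!case: (_ == _).
have inS v : deg2 v -> v \in S by case/andP.
have d2 v : deg2 v -> #|nb S v| <= 2 by case/andP=> _ /eqP->.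
have xN v : deg2 v -> v != x.
  by move=> /andP[_ /eqP dv]; apply/eqP => E; move: d3x; rewrite -E dv.
have ex v : v \in [set a1; a2; a3] -> e v x.
  by rewrite -nbx inE Hsym => /andP[].
have inb u v : deg2 u -> e v u -> u \in nb S v by move=> /inS uS vu; rewrite inE uS.
have xa v : v \in [set a1; a2; a3] -> x \in nb S v by move=> /ex vx; rewrite inE xS.
have nba1 : nb S a1 = [set x; b1].
  by apply: nb2; rewrite ?xa ?inb ?inE ?eqxx // eq_sym xN.
have nba2 : nb S a2 = [set x; b2].
  by apply: nb2; rewrite ?xa ?inb ?inE ?eqxx ?orbT // eq_sym xN.
have nba3 : nb S a3 = [set x; b3].
  by apply: nb2; rewrite ?xa ?inb ?inE ?eqxx ?orbT // eq_sym xN.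
have nbb1 : nb S b1 = [set a1; c1].
  by apply: nb2; rewrite ?inb // Hsym.
have nbb2 : nb S b2 = [set a2; c2].
  by apply: nb2; rewrite ?inb // Hsym.
pose phi1 (phi : T -> bool) v :=
  if v \in [set x; a3] then ~~ phi b3 else if v \in [set a1; a2] then phi b3 else phi v.
(* Reading c1 and c2 through phi1 covers degenerate threads, where c1 or c2 is
   itself recoloured. *)
pose psi phi v := if v == b1 then ~~ phi1 phi c1
  else if v == b2 then ~~ phi1 phi c2 else phi1 phi v.
have DS : [set x; a1; a2; a3; b1; b2] \subset S.
  apply/subsetP => v; rewrite !inE.
  by move=> /orP[/orP[/orP[/orP[/orP[]|]|]|]|] /eqP-> //; apply: inS.
apply: (@recolor [set x; a1; a2; a3; b1; b2] psi) => //.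
- by apply/set0Pn; exists x; rewrite !inE eqxx.
- move=> phi v; rewrite /psi /phi1 !inE !negb_or.
  case/andP=> /andP[/andP[/andP[/andP[]]]].
  by do 6!move=> /negbTE->.
move=> phi v _ vS vD.
have [nb1x nb2x nb3x] : [/\ b1 != x, b2 != x & b3 != x] by split; apply: xN.
have e_ne p q : e p q -> p != q by apply: contraTneq => ->; rewrite Hirr.
have nbc1 : c1 != b1 by rewrite eq_sym e_ne.
have nbc2 : c2 != b2 by rewrite eq_sym e_ne.
(* A vertex with two neighbours of degree 2 is not adjacent to [x], whose degree is 3. *)
have noa w p q : deg2 p -> deg2 q -> nb S w = [set p; q] -> w \notin [set a1; a2; a3].
  move=> dp dq nbw; apply: contraTN isT => /xa; rewrite nbw => /set2P[]E.
    by have := xN _ dp; rewrite E eqxx.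
  by have := xN _ dq; rewrite E eqxx.
have b1a := noa _ _ _ da1 dc1 nbb1; have b2a := noa _ _ _ da2 dc2 nbb2.
(* If [b3] were [a1] or [a2], then [a3] would be its neighbour other than [x], that is [b1] or [b2],
   which is not adjacent to [x]. *)
have b3a : b3 \notin [set a1; a2; a3].
  have aux a b : nb S a = [set x; b] -> b \notin [set a1; a2; a3] -> b3 != a.
    move=> nba ba; apply/eqP => E; have := inb a3 b3 da3; rewrite Hsym E nba.
    move=> /(_ _)/set2P[|E3|E3]; first by rewrite -E.
      by have := xN _ da3; rewrite E3 eqxx.
    by rewrite -E3 !inE eqxx !orbT in ba.
  by rewrite !inE !negb_or (aux a1 b1) // (aux a2 b2) //= eq_sym; apply: e_ne.
(* Otherwise [a1], [b1], [b2], [a2] is a path of four vertices of degree 2. *)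
have nc1b2 : c1 != b2.
  apply/eqP => E; rewrite E in bc1; apply: (@crit_path a1 b1 b2 a2) => //.
  - by rewrite Hsym.
  - by apply: contraNneq b2a => <-; rewrite !inE eqxx.
  - by apply: contraNneq b1a => ->; rewrite !inE eqxx orbT.
have nc2b1 : c2 != b1.
  apply/eqP => E; rewrite E in bc2; apply: (@crit_path a2 b2 b1 a1) => //.
  - by rewrite Hsym.
  - by apply: contraNneq b1a => <-; rewrite !inE eqxx orbT.
  - by apply: contraNneq b2a => ->; rewrite !inE eqxx.
have phi1x : phi1 phi x = ~~ phi b3 by rewrite /phi1 !inE eqxx.
have phi1a3 : phi1 phi a3 = ~~ phi b3 by rewrite /phi1 !inE eqxx orbT.
have phi1a1 : phi1 phi a1 = phi b3.
  by rewrite /phi1 !inE eqxx (negbTE n13) (negbTE (xN _ da1)).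
have phi1a2 : phi1 phi a2 = phi b3.
  by rewrite /phi1 !inE eqxx orbT (negbTE n23) (negbTE (xN _ da2)).
have psiE w : w != b1 -> w != b2 -> psi phi w = phi1 phi w.
  by rewrite /psi => /negbTE-> /negbTE->.
have psia w : w \in [set a1; a2; a3] -> psi phi w = phi1 phi w.
  by move=> wa; apply: psiE; [apply: contraNneq b1a | apply: contraNneq b2a] => <-.
have psix : psi phi x = ~~ phi b3 by rewrite psiE // eq_sym.
have psia1 : psi phi a1 = phi b3 by rewrite psia ?phi1a1 // !inE eqxx.
have psia2 : psi phi a2 = phi b3 by rewrite psia ?phi1a2 // !inE eqxx orbT.
have psia3 : psi phi a3 = ~~ phi b3 by rewrite psia ?phi1a3 // !inE eqxx orbT.
have psib1 : psi phi b1 = ~~ psi phi c1 by rewrite (psiE c1) // /psi eqxx.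
have psib2 : psi phi b2 = ~~ psi phi c2.
  rewrite (psiE c2) // /psi eqxx; case: eqP => // E.
  (* If [b1] and [b2] coincide, then [c1] is [a2] and [c2] is [a1]; these have the same colour, so
     both prescriptions for the shared vertex agree. *)
  have := nbb2; rewrite E nbb1 => /setP E12.
  have := E12 a1; have := E12 a2; rewrite !inE !eqxx (negbTE n12) [a2 == a1]eq_sym.
  by rewrite (negbTE n12) /= => /eqP<- /esym/eqP<-; rewrite phi1a1 phi1a2.
have a3b3 : a3 \in nb S b3 by rewrite inb // Hsym.
(* If [b3] is [b1] or [b2], the thread returns to [x] through [a3]; the recoloured vertex is
   opposite to [a3] and so keeps its former colour. *)
have psib3 : psi phi b3 = phi b3.
  have [E|n31] := eqVneq b3 b1.
    move: a3b3; rewrite E nbb1 => /set2P[E3|E3].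
      by rewrite E3 eqxx in n13.
    by rewrite psib1 -E3 psia3 negbK E.
  have [E|n32] := eqVneq b3 b2.
    move: a3b3; rewrite E nbb2 => /set2P[E3|E3].
      by rewrite E3 eqxx in n23.
    by rewrite psib2 -E3 psia3 negbK E.
  rewrite psiE // /phi1; move: b3a; rewrite !inE !negb_or (negbTE nb3x).
  by case/andP=> /andP[/negbTE-> /negbTE->] /negbTE->.
suff : v \in [:: x; a1; a2; a3; b1; b2; c1; c2; b3].
  have nN (b : bool) : b != ~~ b by case: b.
  have Nn (b : bool) : ~~ b != b by case: b.
  have gd w u : deg2 w -> u \in nb S w -> psi phi u != psi phi w ->
      good S (psi phi) w by move=> dw; apply: good_deg2; apply: d2.
  rewrite !inE => /orP[|/or4P[| | |/or4P[| | |/orP[]]]] /eqP->.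
  - apply: (@good_deg3 _ _ _ a1 a2 a3); rewrite ?d3x ?nbx ?psix ?psia1 ?psia2 //;
    by rewrite ?inE ?eqxx ?orbT.
  - by apply: (gd _ x); rewrite ?psix ?psia1 // nba1 !inE eqxx.
  - by apply: (gd _ x); rewrite ?psix ?psia2 // nba2 !inE eqxx.
  - by apply: (gd _ b3); rewrite ?psib3 ?psia3 // nba3 !inE eqxx orbT.
  - by apply: (gd _ c1); rewrite ?psib1 // nbb1 !inE eqxx orbT.
  - by apply: (gd _ c2); rewrite ?psib2 // nbb2 !inE eqxx orbT.
  - by apply: (gd _ b1); rewrite ?psib1 // inb // Hsym.
  - by apply: (gd _ b2); rewrite ?psib2 // inb // Hsym.
  - by apply: (gd _ a3); rewrite ?psib3 ?psia3.
case: vD => [|/(nb_meet vS DS)[u + uv]].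
  by rewrite !inE => /orP[/orP[/orP[/orP[/orP[]|]|]|]|] /eqP->; rewrite eqxx ?orbT.
rewrite !inE => /orP[/orP[/orP[/orP[/orP[]|]|]|]|] /eqP Eu; move: uv;
  rewrite Eu ?nbx ?nba1 ?nba2 ?nba3 ?nbb1 ?nbb2 !inE -?orbA.
- by move=> /or3P[]/eqP->; rewrite eqxx ?orbT.
all: by move=> /orP[]/eqP->; rewrite eqxx ?orbT.
Qed.

(** * Double counting of threads at vertices of degree 3 *)

Definition cubic v := (v \in S) && (#|nb S v| == 3).

Lemma deg2or3 v : v \in S -> deg2 v || cubic v.
Proof.
by move=> vS; rewrite /deg2 /cubic vS; have := crit_deg vS; have := deg3 vS; lia.
Qed.

(* A thread starting at the cubic vertex x is followed for at most three steps,
   which is enough by crit_path. *)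
Definition walk1 x a := [&& cubic x, a \in nb S x & deg2 a].
Definition walk2 x a b := [&& walk1 x a, b \in nb S a, b != x & deg2 b].
Definition walk3 x a b c := [&& walk2 x a b, c \in nb S b, c != a & deg2 c].

(** For cubic [x], the length of the thread leaving [x] through [a], cut off at 3: a walk has at
    most one continuation, so each extension adds 0 or 1. Written as a sum over walks, it can be
    re-indexed by the end vertex. *)
Definition thread_len x a : nat :=
  walk1 x a + \sum_b (walk2 x a b + \sum_c walk3 x a b c).

Lemma walk_nb x a b : cubic x -> walk2 x a b -> nb S a = [set x; b].
Proof.
move=> /andP[xS _] /and4P[/and3P[_ ax da] ba bx db].
by apply: nb2; rewrite // 1?eq_sym // nb_sym //; case/andP: da.
Qed.

(** A vertex of degree 2 entered from one neighbour can only be left towards the other, so each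
    inner sum has at most one nonzero term. *)
Lemma thread_lenP x a : cubic x ->
  [/\ thread_len x a <= 3,
      2 <= thread_len x a -> exists b, walk2 x a b &
      3 <= thread_len x a -> exists b c, walk3 x a b c].
Proof.
move=> cx; pose g b := \sum_c (walk3 x a b c : nat).
have walk3_2 b c : walk3 x a b c -> walk2 x a b by case/andP.
have gP b : g b = 0 \/ g b = 1 /\ exists c, walk3 x a b c.
  rewrite /g; have [|->|[c [c0 ->]]] := @sum_uniq _ (fun c => walk3 x a b c : nat).
  - move=> c c'; rewrite !lt0b => w w'; have w2 := walk3_2 _ _ w.
    case/and4P: w => _ cb ca dc; case/and4P: w' => _ c'b c'a dc'.
    case/and4P: w2 => w1 ba _ db.
    have aS : a \in S by case/and3P: w1 => _ _ /andP[].
    have bS : b \in S by case/andP: db.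
    have nbb : nb S b = [set a; c] by apply: nb2; rewrite // 1?eq_sym // nb_sym.
    by move: c'b; rewrite nbb => /set2P[E|//]; rewrite E eqxx in c'a.
  - by left.
  by right; move: c0; rewrite lt0b => w; split; [rewrite w | exists c].
have g0 b : ~~ walk2 x a b -> g b = 0.
  by move=> nw; case: (gP b) => // -[_ [c /walk3_2]]; rewrite (negbTE nw).
rewrite -[thread_len x a]/(walk1 x a + \sum_b (walk2 x a b + g b)).
have [|->|[b [b0 ->]]] := @sum_uniq _ (fun b => walk2 x a b + g b).
- have pos u : 0 < walk2 x a u + g u -> walk2 x a u.
    by apply: contraTT => nw; rewrite g0 // (negbTE nw).
  move=> b b' /pos w /pos w'; have := walk_nb cx w'.
  case/and4P: (w) => _ ba bx _; case/and4P: (w') => _ _ _ _ E.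
  by move: ba; rewrite E => /set2P[E'|//]; rewrite E' eqxx in bx.
- by split; case: (walk1 _ _).
have w2 : walk2 x a b.
  by apply: contraTT b0 => nw; rewrite g0 // (negbTE nw).
split; first by case: (gP b) => [->|[-> _]]; case: (walk1 _ _); case: (walk2 _ _ _).
  by exists b.
case: (gP b) => [->|[-> [c w3]]]; last by exists b, c.
by case: (walk1 _ _); case: (walk2 _ _ _).
Qed.

(** At a cubic vertex, three lengths of at most 3 with sum at least 8 are 3, 3 and at least 2 in
    some order, which [crit_332] excludes. No walk starts at any other vertex. *)
Lemma threads_le7 x : \sum_a thread_len x a <= 7 * cubic x.
Proof.
case: (boolP (cubic x)) => cx; last first.
  rewrite big1 // => a _; rewrite /thread_len /walk3 /walk2 /walk1 (negbTE cx) /=.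
  by rewrite big1 // => b _; rewrite big1.
have /andP[xS /eqP d3x] := cx.
rewrite (bigID (mem (nb S x))) /= [X in _ + X]big1 ?addn0; last first.
  move=> a ax; rewrite /thread_len /walk3 /walk2 /walk1 (negbTE ax) andbF.
  by rewrite big1 // => b _; rewrite big1.
have /cards3E[a1 [a2 [a3 [nbx n12 n13 n23]]]] := d3x.
have -> : \sum_(a in nb S x) thread_len x a =
          thread_len x a1 + thread_len x a2 + thread_len x a3.
  have a3n : a3 \notin [set a1; a2] by rewrite !inE ![a3 == _]eq_sym negb_or n13 n23.
  have a1n : a1 \notin [set a2] by rewrite inE.
  by rewrite nbx setUC (big_setU1 _ a3n) (big_setU1 _ a1n) big_set1 /= addnC.
rewrite leqNgt; apply/negP => big.
have key p q r : nb S x = [set p; q; r] ->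
    3 <= thread_len x p -> 3 <= thread_len x q -> 2 <= thread_len x r -> False.
  move=> nbp lp lq lr.
  have [_ _ /(_ lp)[b1 [c1 w1]]] := thread_lenP p cx.
  have [_ _ /(_ lq)[b2 [c2 w2]]] := thread_lenP q cx.
  have [_ /(_ lr)[b3 w3] _] := thread_lenP r cx.
  case/and4P: w1 => /and4P[/and3P[_ _ dp] b1p b1x db1] c1b c1p dc1.
  case/and4P: w2 => /and4P[/and3P[_ _ dq] b2q b2x db2] c2b c2q dc2.
  case/and4P: w3 => /and3P[_ _ dr] b3r b3x db3.
  have nbe u v : u \in nb S v -> e v u by rewrite inE => /andP[].
  apply: (@crit_332 x p b1 c1 q b2 c2 r b3) => //; try exact: nbe.
    by rewrite eq_sym.
  by rewrite eq_sym.
have [l1 _ _] := thread_lenP a1 cx; have [l2 _ _] := thread_lenP a2 cx.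
have [l3 _ _] := thread_lenP a3 cx.
have /or3P[] :
  [|| [&& 3 <= thread_len x a1, 3 <= thread_len x a2 & 2 <= thread_len x a3],
      [&& 3 <= thread_len x a1, 3 <= thread_len x a3 & 2 <= thread_len x a2] |
      [&& 3 <= thread_len x a2, 3 <= thread_len x a3 & 2 <= thread_len x a1]] by lia.
- by case/and3P; apply: key.
- by case/and3P; apply: key; rewrite nbx setUAC.
by case/and3P; apply: key; rewrite nbx [RHS]setUC setUA.
Qed.

Lemma other_nb u v : u \in S -> exists2 t, t \in nb S u & t != v.
Proof.
move=> uS; have := crit_deg uS; rewrite (cardsD1 v) => h.
have /card_gt0P[t] : 0 < #|nb S u :\ v| by move: h; case: (v \in _) => /=; lia.
by rewrite in_setD1 => /andP[tv tu]; exists t.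
Qed.

(** From [v], each of its two directions is followed through [u], [t], [s] without turning back. By
    [crit_path] one of these is cubic, and from the first such vertex a walk leads back to [v]. *)
Lemma threads_ge2 v :
  2 * deg2 v <= \sum_u (walk1 u v + \sum_t (walk2 t u v + \sum_s walk3 s t u v)).
Proof.
case: (boolP (deg2 v)) => // dv.
have vS : v \in S by case/andP: dv.
have nbS p q : p \in nb S q -> p \in S by rewrite inE => /andP[].
have nbe p q : p \in nb S q -> e q p by rewrite inE => /andP[].
pose h u := walk1 u v + \sum_t (walk2 t u v + \sum_s walk3 s t u v).
have hP u : u \in nb S v -> 0 < h u.
  move=> uv; have uS := nbS _ _ uv; have vu : v \in nb S u by rewrite nb_sym.
  rewrite /h; case/orP: (deg2or3 uS) => du; last by rewrite /walk1 du vu dv.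
  have [t tu tv] := other_nb v uS; have tS := nbS _ _ tu.
  have ut : u \in nb S t by rewrite nb_sym.
  apply: leq_trans (leq_addl _ _); rewrite (bigD1 t) //=.
  case/orP: (deg2or3 tS) => dt.
    have [s st su] := other_nb u tS; have sS := nbS _ _ st.
    have ts : t \in nb S s by rewrite nb_sym.
    case/orP: (deg2or3 sS) => ds.
      case: (@crit_path v u t s); rewrite // 1?eq_sym //; exact: nbe.
    have w : walk3 s t u v.
      by rewrite /walk3 /walk2 /walk1 ds ts dt ut du vu dv ![_ == s]eq_sym su
                 [v == _]eq_sym tv.
    apply: leq_trans (leq_addr _ _); apply: leq_trans (leq_addl _ _).
    by rewrite (bigD1 s) //= w.
  have w : walk2 t u v by rewrite /walk2 /walk1 dt ut du vu dv [v == _]eq_sym tv.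
  by do 2!apply: leq_trans (leq_addr _ _); rewrite w.
rewrite muln1; have [u uv _] := other_nb v vS; have [w wv wu] := other_nb u vS.
change (1 < \sum_u h u); rewrite (bigD1 u) // (bigD1 w) //= addnA.
exact: leq_trans (leq_add (hP u uv) (hP w wv)) (leq_addr _ _).
Qed.

(** Walks are counted by first vertex, at most 7 for each cubic one, and by last vertex, at least 2
    for each of degree 2. *)
Lemma deg2_le_cubic : 2 * \sum_v deg2 v <= 7 * \sum_v cubic v.
Proof.
rewrite !big_distrr /=; apply: (@leq_trans (\sum_x \sum_a thread_len x a)); last first.
  by apply: leq_sum => x _; apply: threads_le7.
have -> : \sum_x \sum_a thread_len x a =
    \sum_v \sum_u (walk1 u v + \sum_t (walk2 t u v + \sum_s walk3 s t u v)).
  have split3 (f : T -> T -> nat) (g : T -> T -> T -> nat)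
      (h : T -> T -> T -> T -> nat) :
      \sum_x \sum_a (f x a + \sum_b (g x a b + \sum_c h x a b c)) =
      \sum_x \sum_a f x a + (\sum_x \sum_a \sum_b g x a b +
                             \sum_x \sum_a \sum_b \sum_c h x a b c).
    rewrite -!big_split; apply: eq_bigr => x _; rewrite -!big_split.
    by apply: eq_bigr => a _; rewrite -!big_split.
  rewrite !split3 exchange_big /=; congr (_ + (_ + _)); first exact: sum_rev3.
  exact: sum_rev4.
by apply: leq_sum => v _; apply: threads_ge2.
Qed.

(** With $n_2$ and $n_3$ vertices of degrees 2 and 3, the difference of the two sides is
    $9(2n_2+3n_3)-20(n_2+n_3)=7n_3-2n_2$. *)
Lemma crit_dense : 20 * #|S| <= 9 * \sum_(v in S) #|nb S v|.
Proof.
have -> : #|S| = \sum_v deg2 v + \sum_v cubic v.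
  rewrite -sum1_card big_mkcond -big_split; apply: eq_bigr => v _ /=.
  case: ifP => [vS|vS]; last by rewrite /deg2 /cubic vS.
  by move: (deg2or3 vS); rewrite /deg2 /cubic vS; case: eqP => [->|]; case: eqP.
have -> : \sum_(v in S) #|nb S v| = 2 * (\sum_v deg2 v) + 3 * \sum_v cubic v.
  rewrite !big_distrr big_mkcond -big_split; apply: eq_bigr => v _ /=.
  case: ifP => [vS|vS]; last by rewrite /deg2 /cubic vS.
  by move: (deg2or3 vS); rewrite /deg2 /cubic vS; case: eqP => [->|] //= _ /eqP->.
have := deg2_le_cubic; lia.
Qed.

End Critical.

(** * Degree sums against the maximum average degree *)

Section Density.
Variables (T : finType) (e : rel T).
Hypotheses (Hsym : symmetric e) (Hirr : irreflexive e).

(** Handshake count: the degree sum counts ordered adjacent pairs in [S], and an edge arises from at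
    most two of them. *)
Lemma sum_nb_le (S : {set T}) :
  \sum_(v in S) #|nb e S v| <= 2 * #|[set f in edges e | f \subset S]|.
Proof.
under eq_bigr => v _ do rewrite -sum1_card.
rewrite pair_big_dep /=.
rewrite (partition_big (fun p : T * T => [set p.1; p.2])
  (mem [set f in edges e | f \subset S])) /=; last first.
  move=> [v u] /=; rewrite !inE => /andP[vS /andP[uS vu]].
  apply/andP; split; last by apply/subsetP => w /set2P[]->.
  by apply/existsP; exists v; apply/existsP; exists u; rewrite vu eqxx.
rewrite mulnC -sum_nat_const; apply: leq_sum => f.
rewrite inE => /andP[/edgesP[x [y [xy ->]]] _].
rewrite sum1dep_card; apply: (@leq_trans #|[set (x, y); (y, x)]|).
  apply: subset_leq_card; apply/subsetP => -[v u]; rewrite !inE /=.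
  move=> /andP[/andP[_ /andP[_ vu]] /eqP E]; rewrite !xpair_eqE.
  have nvu : v != u by apply: contraTneq vu => ->; rewrite Hirr.
  move: nvu; have : u \in [set x; y] by rewrite -E !inE eqxx orbT.
  have : v \in [set x; y] by rewrite -E !inE eqxx.
  by move=> /set2P[]-> /set2P[]->; rewrite ?eqxx ?orbT.
by rewrite cards2; case: (_ == _).
Qed.

Lemma mad_sum_nb (S : {set T}) : mad_lt e (20%:Q / 9%:Q)%R -> S != set0 ->
  9 * \sum_(v in S) #|nb e S v| < 20 * #|S|.
Proof.
move=> mad S0; have := sum_nb_le S.
set F := [set f in edges e | f \subset S] => hF.
have subF : is_subgraph e S F.
  by split=> [|f]; [apply/subsetP => f|]; rewrite inE => /andP[].
have S_gt0 : 0 < #|S| by rewrite card_gt0.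
have := mad S F subF S0.
rewrite ltr_pdivrMr ?ltr0n // mulrAC ltr_pdivlMr // -!natrM ltr_nat => h.
by apply: leq_ltn_trans h; rewrite mulnC leq_mul2r hF.
Qed.

(** Replacing colourings by finite functions makes [balanceable] decidable, so a minimal
    counterexample can be argued by contradiction constructively. *)
Lemma balanceableP (S : {set T}) : reflect (balanceable e S)
  [exists phi : {ffun T -> bool}, [forall v in S, good e S phi v]].
Proof.
apply: (iffP existsP) => [[phi /forall_inP]|[phi phiP]]; first by exists phi.
exists (finfun phi); apply/forall_inP => v /phiP; rewrite /good.
by congr (_ && _); congr (_ <= _); apply: eq_card => u; rewrite !inE !ffunE.
Qed.

(** Strong induction on the size of [S]: a failing [S] all of whose proper subsets are balanceable
    is too dense by [crit_dense]. *)
Lemma mad_balanceable : subcubic e -> mad_lt e (20%:Q / 9%:Q)%R ->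
  forall S, balanceable e S.
Proof.
move=> sub mad S; have [n] := ubnP #|S|; elim: n S => // n IH S; rewrite ltnS => Sn.
apply/balanceableP; apply: contraT => /balanceableP crit.
have S0 : S != set0.
  by apply/eqP => E; apply: crit; exists xpredT => v; rewrite E inE.
have deg3 v : v \in S -> #|nb e S v| <= 3.
  move=> _; apply: leq_trans (sub v); apply: subset_leq_card.
  by apply/subsetP => u; rewrite !inE => /andP[].
have := mad_sum_nb mad S0; rewrite ltnNge crit_dense // => S' /proper_card.
by move=> lt; apply: IH; apply: leq_trans lt Sn.
Qed.
End Density.

Theorem theorem2 (T : finType) (e : rel T)
  (Hsym : symmetric e) (Hirr : irreflexive e)
  (Hsub : subcubic e) (Hmad : mad_lt e (20%:Q / 9%:Q)%R) :
  packing_1122 e.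
Proof.
have [phi phiP] := mad_balanceable Hsym Hirr Hsub Hmad setT.
apply: (balanced_packing Hsym (phi := phi)) => v.
have /andP[s o] := phiP v (in_setT v).
split; [apply: leq_trans s | apply: leq_trans o]; apply: subset_leq_card;
  by apply/subsetP => u; rewrite !inE.
Qed.
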